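(* Let $P=[0,1]^2$. No online algorithm for the ATWC dispersion problem in $P$ achieves a competitive ratio better than $1.183$.
   Context: Let $P\subset\mathbb{R}^k$ be a $k$-dimensional polytope with boundary $\partial P$; distances are Euclidean. An instance is a sequence $S=((s_1,d_1),\dots,(s_n,d_n))$ with $s_i<d_i$, $0=s_1\le\dots\le s_n$; point $i$ is present at time $t$ iff $s_i\le t\le d_i$; $T=\max_i d_i$. For locations $X=(X_1,\dots,X_n)\in P^n$, $d_{min}(t;X)=\min\{dis(X_i,\partial P),dis(X_i,X_j)\}$ over present points $i\ne j$ at time $t$, and $OPT_A(S;P)=\max_X\min_{t\le T}d_{min}(t;X)$. In the online ATWC problem, when point $i$ arrives the algorithm must irrevocably choose $X_i\in P$ knowing only past events (not future events nor $n$); an adaptive adversary who knows the algorithm chooses the events. An online algorithm is $\sigma$-competitive if for every instance $S$, $OPT_A(S;P)\le\sigma\cdot\min_{t\le T}d_{min}(t;X)$ for its output $X$. *)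

(* Defs.v *)
From Stdlib Require Import Reals List.
From Coquelicot Require Import Coquelicot.
Open Scope R_scope.

Definition pt := (R * R)%type.

Definition dist (X Z : pt) : R :=
  sqrt ((fst X - fst Z) ^ 2 + (snd X - snd Z) ^ 2).

Definition inP (X : pt) : Prop :=
  0 <= fst X <= 1 /\ 0 <= snd X <= 1.

Definition onBoundary (Z : pt) : Prop :=
  inP Z /\ (fst Z = 0 \/ fst Z = 1 \/ snd Z = 0 \/ snd Z = 1).

Definition dist_bd (X : pt) : Rbar :=
  Glb_Rbar (fun v => exists Z, onBoundary Z /\ v = dist X Z).

(* An instance: list of (s_i, d_i), indices 0..n-1 (paper's 1..n). *)
Definition instance := list (R * R).

Definition s_ (S : instance) (i : nat) : R := fst (nth i S (0, 0)).
Definition d_ (S : instance) (i : nat) : R := snd (nth i S (0, 0)).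

Definition valid_instance (S : instance) : Prop :=
  S <> nil /\ s_ S 0 = 0 /\
  (forall i, (i < length S)%nat -> s_ S i < d_ S i) /\
  (forall i j, (i <= j < length S)%nat -> s_ S i <= s_ S j).

Definition Tmax (S : instance) : R := fold_right Rmax 0 (map snd S).

Definition present (S : instance) (t : R) (i : nat) : Prop :=
  s_ S i <= t <= d_ S i.

Definition presentb (S : instance) (t : R) (i : nat) : bool :=
  if Rle_dec (s_ S i) t then (if Rle_dec t (d_ S i) then true else false)
  else false.

Definition dmin (S : instance) (X : nat -> pt) (t : R) : Rbar :=
  let n := length S in
  let idx := List.seq 0 n in
  fold_right Rbar_min p_infty
    (map (fun i =>
       if presentb S t i then
         Rbar_min (dist_bd (X i))
           (fold_right Rbar_min p_infty
              (map (fun j =>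
                 if presentb S t j then (if Nat.eqb i j then p_infty
                                         else Finite (dist (X i) (X j)))
                 else p_infty) idx))
       else p_infty) idx).

Definition minval (S : instance) (X : nat -> pt) : Rbar :=
  Glb_Rbar (fun v => exists t, 0 <= t <= Tmax S /\ dmin S X t = Finite v).

Definition OPT_A (S : instance) : Rbar :=
  Lub_Rbar (fun v => exists X : nat -> pt,
    (forall i, (i < length S)%nat -> inP (X i)) /\ minval S X = Finite v).

(* A deterministic online algorithm: given the whole instance S and an index i,
   it outputs X_i; it must be causal: X_i depends only on what is known at the
   arrival of point i (the index i, the arrival times s_0..s_i, and the
   departure times d_j, j < i, of those points that already departed, i.e.
   d_j <= s_i).  n and future events are not part of the view. *)
Definition algorithm := instance -> nat -> pt.

Definition view (S : instance) (i : nat) : list (R * option R) :=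
  map (fun j => (s_ S j,
                 if Nat.ltb j i then
                   (if Rle_dec (d_ S j) (s_ S i) then Some (d_ S j) else None)
                 else None))
      (List.seq 0 (Datatypes.S i)).

Definition online (A : algorithm) : Prop :=
  (forall S i, valid_instance S -> (i < length S)%nat -> inP (A S i)) /\
  (forall S S' i, valid_instance S -> valid_instance S' ->
     (i < length S)%nat -> (i < length S')%nat ->
     view S i = view S' i -> A S i = A S' i).

Definition competitive (A : algorithm) (sigma : R) : Prop :=
  forall S, valid_instance S ->
    Rbar_le (OPT_A S) (Rbar_mult sigma (minval S (A S))).

(* Main.v *)
(** The adversary only inserts points, and may stop after any number [n] of
    them; so the algorithm fixes one sequence [x_0, x_1, ...], and every prefix
    of length [n] must be dispersed at scale [g n / sigma], where
    [g n = sqrt (1.154 / n)] is achieved offline by a triangular lattice for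
    large [n].  Points of later index may thus be close, but [x_i] and [x_j] are
    at distance at least [g (max i j + 1) / sigma].  For [M = 4 m], give the
    first [m] points disks of radius [g M / sigma] and each later [x_i] the radius
    [(g (i + 1) - g M) / sigma].  As [g m = 2 g M], these disks are disjoint
    and inside the square, and as [m] grows their total area tends to
    [PI * 1.154 * (2 ln 2 - 1) / sigma ^ 2], so it exceeds 1 when
    [sigma < 1.183].  (With the exact lattice constant [2 / sqrt 3] instead of
    1.154, the bound obtained is about 1.1837.) *)

Require Import Defs.
From Stdlib Require Import Reals List Lra Lia Machin.
From Coquelicot Require Import Coquelicot.
Open Scope R_scope.

(** * Area of disjoint disks in the unit square *)

Definition lsum (f : nat -> R) (l : list nat) : R :=
  fold_right (fun i a => f i + a) 0 l.

Lemma lsum_filter (f : nat -> R) (p : nat -> bool) (l : list nat) :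
  lsum f l = lsum f (filter p l) + lsum f (filter (fun i => negb (p i)) l).
Proof.
  induction l as [|i l IH]; simpl; [lra|].
  unfold lsum in *. destruct (p i); simpl; lra.
Qed.

Lemma lsum_eq_0 (f : nat -> R) (l : list nat) :
  (forall i, In i l -> f i = 0) -> lsum f l = 0.
Proof.
  induction l as [|i l IH]; simpl; intros H; [easy|].
  rewrite (H i), IH; auto; lra.
Qed.

Lemma lsum_le (f g : nat -> R) (l : list nat) :
  (forall i, In i l -> f i <= g i) -> lsum f l <= lsum g l.
Proof.
  induction l as [|i l IH]; simpl; intros H; [lra|].
  apply Rplus_le_compat; auto.
Qed.

Lemma lsum_scal (f : nat -> R) (k : R) (l : list nat) :
  lsum (fun i => k * f i) l = k * lsum f l.
Proof.
  induction l as [|i l IH]; simpl; [lra|]. rewrite IH; lra.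
Qed.

Lemma lsum_app (f : nat -> R) (l l' : list nat) :
  lsum f (l ++ l') = lsum f l + lsum f l'.
Proof.
  induction l as [|i l IH]; simpl; [lra|]. rewrite IH; lra.
Qed.

(** As in quicksort, one interval serves as pivot: the others with centre on its left lie in
    [[a, c k - h k]], the rest in [[c k + h k, b]], and both groups are handled by induction. *)
Lemma disjoint_intervals_length (c h : nat -> R) (l : list nat) (a b : R) :
  NoDup l -> a <= b ->
  (forall i, In i l -> 0 < h i /\ a <= c i - h i /\ c i + h i <= b) ->
  (forall i j, In i l -> In j l -> i <> j -> h i + h j <= Rabs (c i - c j)) ->
  2 * lsum h l <= b - a.
Proof.
  (* The induction runs on an upper bound for the length, since the two filtered lists have unknown
     lengths. *)
  remember (length l) as n eqn:Hn.
  assert (Hl : (length l <= n)%nat) by lia. clear Hn.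
  revert l a b Hl. induction n as [|n IH]; intros l a b Hl ND Hab Hin Hd.
  - destruct l; simpl in *; [lra|lia].
  - destruct l as [|k l]; simpl in *; [lra|].
    inversion ND as [|? ? Hk ND']; subst.
    destruct (Hin k (or_introl eq_refl)) as (h0 & ha & hb).
    pose (p := fun i => if Rle_dec (c i) (c k) then true else false).
    assert (HL : 2 * lsum h (filter p l) <= (c k - h k) - a).
    { apply IH.
      - pose proof (filter_length_le p l). lia.
      - now apply NoDup_filter.
      - lra.
      - intros i Hi. apply filter_In in Hi. destruct Hi as [Hi Hp].
        unfold p in Hp. destruct (Rle_dec (c i) (c k)); [|easy].
        destruct (Hin i (or_intror Hi)) as (? & ? & ?).
        assert (i <> k) by congruence.
        pose proof (Hd i k (or_intror Hi) (or_introl eq_refl) H2) as HH.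
        rewrite Rabs_left1 in HH; lra.
      - intros i j Hi Hj. apply filter_In in Hi, Hj. apply Hd; right; tauto. }
    assert (HR : 2 * lsum h (filter (fun i => negb (p i)) l) <= b - (c k + h k)).
    { apply IH.
      - pose proof (filter_length_le (fun i => negb (p i)) l). lia.
      - now apply NoDup_filter.
      - lra.
      - intros i Hi. apply filter_In in Hi. destruct Hi as [Hi Hp].
        unfold p in Hp. destruct (Rle_dec (c i) (c k)); [easy|].
        destruct (Hin i (or_intror Hi)) as (? & ? & ?).
        assert (i <> k) by congruence.
        pose proof (Hd i k (or_intror Hi) (or_introl eq_refl) H2) as HH.
        rewrite Rabs_right in HH; lra.
      - intros i j Hi Hj. apply filter_In in Hi, Hj. apply Hd; right; tauto. }
    rewrite (lsum_filter h p l). lra.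
Qed.

(** A horizontal line at heights [a] and [b] relative to the centres of two disjoint disks cuts them
    in non-overlapping chords. The product of the half-chords is at most [r * s + a * b], because
    [(r * s + a * b)^2] exceeds its square by [(r * b + s * a)^2]; hence the squared sum is at most
    [(r + s)^2 - (a - b)^2]. *)
Lemma chord_disjoint (dx a b r s : R) :
  0 <= r -> 0 <= s -> a ^ 2 <= r ^ 2 -> b ^ 2 <= s ^ 2 ->
  (r + s) ^ 2 <= dx ^ 2 + (a - b) ^ 2 ->
  sqrt (r ^ 2 - a ^ 2) + sqrt (s ^ 2 - b ^ 2) <= Rabs dx.
Proof.
  intros Hr Hs Ha Hb Hd.
  assert (Hra : - r <= a <= r) by (split; nra).
  assert (Hsb : - s <= b <= s) by (split; nra).
  assert (Hm : sqrt (r ^ 2 - a ^ 2) * sqrt (s ^ 2 - b ^ 2) <= r * s + a * b).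
  { rewrite <- sqrt_mult by lra.
    rewrite <- (sqrt_pow2 (r * s + a * b)) by nra.
    apply sqrt_le_1_alt. pose proof (pow2_ge_0 (r * b + s * a)). nra. }
  pose proof (pow2_sqrt (r ^ 2 - a ^ 2) ltac:(lra)).
  pose proof (pow2_sqrt (s ^ 2 - b ^ 2) ltac:(lra)).
  apply Rsqr_incr_0_var; [|apply Rabs_pos].
  rewrite <- Rsqr_abs. unfold Rsqr. nra.
Qed.

(** For a disk of radius [r] centred at height [y], cut at height [t]. Since [sqrt] is 0 on negative
    numbers, this vanishes where the line misses the disk and is continuous everywhere. *)
Definition half_chord (y r t : R) : R := sqrt (r ^ 2 - (t - y) ^ 2).

Lemma half_chord_continuous (y r t : R) : continuous (half_chord y r) t.
Proof.
  apply continuous_sqrt_comp.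
  apply (ex_derive_continuous (fun t => r ^ 2 - (t - y) ^ 2)). auto_derive; easy.
Qed.

Lemma half_chord_ex_RInt (y r a b : R) : ex_RInt (half_chord y r) a b.
Proof.
  apply (ex_RInt_continuous (V := R_CompleteNormedModule)).
  intros; apply half_chord_continuous.
Qed.

(** The substitution [t = y + r * sin p] turns the integrand into [r^2 * cos p ^ 2], with
    antiderivative [r^2 / 2 * (p + sin p * cos p)]. *)
Lemma half_disk_area (y r : R) :
  0 <= r -> RInt (half_chord y r) (y - r) (y + r) = PI / 2 * r ^ 2.
Proof.
  intros Hr. pose proof PI_RGT_0 as HPI.
  assert (Hg : is_RInt (fun p => scal (r * cos p) (half_chord y r (y + r * sin p)))
    (- (PI / 2)) (PI / 2)
    (RInt (half_chord y r) (y + r * sin (- (PI / 2))) (y + r * sin (PI / 2)))).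
  { apply (is_RInt_comp (V := R_CompleteNormedModule)
      (half_chord y r) (fun p => y + r * sin p) (fun p => r * cos p)).
    - intros; apply half_chord_continuous.
    - intros x _; split; [auto_derive; [easy|ring]|].
      apply (ex_derive_continuous (fun p => r * cos p)). auto_derive; easy. }
  rewrite sin_neg, sin_PI2 in Hg.
  replace (y + r * - (1)) with (y - r) in Hg by ring.
  rewrite Rmult_1_r in Hg.
  rewrite <- (is_RInt_unique _ _ _ _ Hg). apply is_RInt_unique.
  apply is_RInt_ext with (fun p => r ^ 2 * cos p ^ 2).
  { intros p. rewrite Rmin_left, Rmax_right by lra. intros Hp.
    unfold half_chord, scal; simpl; unfold mult; simpl.
    assert (0 <= cos p) by (apply cos_ge_0; lra).
    replace (r * (r * 1) - (y + r * sin p - y) * ((y + r * sin p - y) * 1))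
      with ((r * cos p) ^ 2).
    2:{ pose proof (sin2_cos2 p) as E. unfold Rsqr in E.
        transitivity (r ^ 2 * (cos p * cos p)); [ring|].
        replace (cos p * cos p) with (1 - sin p * sin p) by lra. ring. }
    rewrite sqrt_pow2 by nra. ring. }
  replace (PI / 2 * r ^ 2) with
    (minus (r ^ 2 / 2 * (PI / 2 + sin (PI / 2) * cos (PI / 2)))
       (r ^ 2 / 2 * (- (PI / 2) + sin (- (PI / 2)) * cos (- (PI / 2))))).
  2:{ rewrite sin_neg, cos_neg, cos_PI2. unfold minus, plus, opp; simpl. field. }
  apply (is_RInt_derive (fun p => r ^ 2 / 2 * (p + sin p * cos p))
           (fun p => r ^ 2 * cos p ^ 2)).
  - intros p _. auto_derive; [easy|].
    pose proof (sin2_cos2 p) as E. unfold Rsqr in E.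
    replace (sin p * (1 * - sin p)) with (cos p * cos p - 1) by lra. field.
  - intros p _. apply (ex_derive_continuous (fun p => r ^ 2 * cos p ^ 2)).
    auto_derive; easy.
Qed.

Lemma half_disk_area_le (y r : R) :
  0 <= r -> r <= y <= 1 - r -> PI / 2 * r ^ 2 <= RInt (half_chord y r) 0 1.
Proof.
  intros Hr Hy. rewrite <- (half_disk_area y) by easy.
  rewrite <- (RInt_Chasles _ 0 (y - r) 1), <- (RInt_Chasles _ (y - r) (y + r) 1)
    by apply half_chord_ex_RInt.
  assert (forall a b, a <= b -> 0 <= RInt (half_chord y r) a b).
  { intros a b Hab. apply RInt_ge_0; [easy|apply half_chord_ex_RInt|].
    intros; apply sqrt_pos. }
  unfold plus; simpl.
  pose proof (H 0 (y - r) ltac:(lra)). pose proof (H (y + r) 1 ltac:(lra)). lra.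
Qed.

Lemma is_RInt_lsum (f : nat -> R -> R) (l : list nat) (a b : R) :
  (forall i, ex_RInt (f i) a b) ->
  is_RInt (fun t => lsum (fun i => f i t) l) a b (lsum (fun i => RInt (f i) a b) l).
Proof.
  intros Hf. induction l as [|i l IH]; simpl.
  - assert (H : is_RInt (fun _ => 0) a b ((b - a) * 0))
      by exact (is_RInt_const (V := R_NormedModule) a b 0).
    now rewrite Rmult_0_r in H.
  - apply (is_RInt_plus (V := R_NormedModule) (f i)); [|exact IH].
    apply (RInt_correct (V := R_CompleteNormedModule)), Hf.
Qed.

(** Cavalieri's principle: at each height the chords are disjoint intervals in [[0, 1]], so the
    half-chords sum to at most 1/2; integrating over the height bounds the sum of the half-disk
    areas. *)
Lemma disjoint_disks_area (X : nat -> pt) (r : nat -> R) (l : list nat) :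
  NoDup l ->
  (forall i, In i l -> 0 <= r i /\ r i <= fst (X i) <= 1 - r i
                       /\ r i <= snd (X i) <= 1 - r i) ->
  (forall i j, In i l -> In j l -> i <> j -> r i + r j <= Defs.dist (X i) (X j)) ->
  PI * lsum (fun i => r i ^ 2) l <= 1.
Proof.
  intros ND Hin Hd.
  set (h := fun i => half_chord (snd (X i)) (r i)).
  assert (Hslice : forall t, lsum (fun i => h i t) l <= 1 / 2).
  { intros t.
    (* Only disks with a chord of positive length are kept: the two lemmas on intervals and chords
       require it, and the other disks contribute 0. *)
    pose (p := fun i => if Rlt_dec 0 (h i t) then true else false).
    assert (Hp : forall i, In i (filter p l) -> In i l /\ 0 < h i t).
    { intros i Hi. apply filter_In in Hi. destruct Hi as [Hi Hpi]. unfold p in Hpi.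
      destruct (Rlt_dec 0 (h i t)); easy. }
    assert (Hpos : forall i, 0 < h i t -> (t - snd (X i)) ^ 2 <= r i ^ 2).
    { intros i Hi. unfold h, half_chord in Hi.
      destruct (Rle_lt_dec ((t - snd (X i)) ^ 2) (r i ^ 2)) as [|C]; [easy|].
      rewrite sqrt_neg_0 in Hi; lra. }
    rewrite (lsum_filter _ p), (lsum_eq_0 _ (filter (fun i => negb (p i)) l)).
    2:{ intros i Hi. apply filter_In in Hi. destruct Hi as [_ Hpi]. unfold p in Hpi.
        destruct (Rlt_dec 0 (h i t)) as [|n]; [easy|].
        assert (0 <= h i t) by apply sqrt_pos. lra. }
    enough (2 * lsum (fun i => h i t) (filter p l) <= 1 - 0) by lra.
    apply (disjoint_intervals_length (fun i => fst (X i))).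
    - now apply NoDup_filter.
    - lra.
    - intros i Hi. destruct (Hp i Hi) as [Hl Hi0].
      destruct (Hin i Hl) as (? & ? & ?).
      assert (h i t <= r i).
      { unfold h, half_chord. rewrite <- (sqrt_pow2 (r i)) at 2 by easy.
        apply sqrt_le_1_alt. pose proof (pow2_ge_0 (t - snd (X i))). lra. }
      lra.
    - intros i j Hi Hj Hij. destruct (Hp i Hi) as [Hil Hi0].
      destruct (Hp j Hj) as [Hjl Hj0].
      destruct (Hin i Hil) as (Hri & _). destruct (Hin j Hjl) as (Hrj & _).
      apply chord_disjoint; auto.
      pose proof (Hd i j Hil Hjl Hij) as Hdij. unfold Defs.dist in Hdij.
      pose proof (pow2_ge_0 (fst (X i) - fst (X j))).
      pose proof (pow2_ge_0 (snd (X i) - snd (X j))).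
      replace (t - snd (X i) - (t - snd (X j))) with (- (snd (X i) - snd (X j))) by ring.
      rewrite <- (Rsqr_pow2 (- _)), <- Rsqr_neg, Rsqr_pow2.
      rewrite <- (pow2_sqrt ((fst (X i) - fst (X j)) ^ 2 + _)) by lra.
      apply pow_incr; lra. }
  assert (HI := is_RInt_lsum h l 0 1
    (fun i => half_chord_ex_RInt (snd (X i)) (r i) 0 1)).
  assert (Hle : lsum (fun i => RInt (h i) 0 1) l <= 1 / 2).
  { rewrite <- (is_RInt_unique _ _ _ _ HI).
    apply Rle_trans with (RInt (fun _ => 1 / 2) 0 1).
    - apply RInt_le; [lra|eexists; exact HI|apply ex_RInt_const|].
      intros; apply Hslice.
    - rewrite RInt_const. unfold scal; simpl; unfold mult; simpl. lra. }
  assert (lsum (fun i => PI / 2 * r i ^ 2) l <= lsum (fun i => RInt (h i) 0 1) l).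
  { apply lsum_le. intros i Hi. destruct (Hin i Hi) as (? & ? & ?).
    now apply half_disk_area_le. }
  rewrite lsum_scal in H. lra.
Qed.

(** * Sum estimates and numerical constants *)

Lemma ln_le_minus_1 (x : R) : 0 < x -> ln x <= x - 1.
Proof.
  intros Hx. pose proof (exp_ineq1_le (ln x)) as H. rewrite exp_ln in H; lra.
Qed.

Lemma ln_succ_sub_le (x : R) : 0 < x -> ln (x + 1) - ln x <= / x.
Proof.
  intros Hx. rewrite <- ln_div by lra.
  replace (/ x) with ((x + 1) / x - 1) by (field; lra).
  apply ln_le_minus_1, Rdiv_lt_0_compat; lra.
Qed.

Lemma inv_sqrt_succ_le (x : R) :
  0 <= x -> / sqrt (x + 1) <= 2 * (sqrt (x + 1) - sqrt x).
Proof.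
  intros Hx.
  assert (H1 : 0 < sqrt (x + 1)) by (apply sqrt_lt_R0; lra).
  pose proof (pow2_sqrt x Hx). pose proof (pow2_sqrt (x + 1) ltac:(lra)).
  apply Rmult_le_reg_l with (sqrt (x + 1)); [easy|].
  rewrite Rinv_r by lra.
  pose proof (pow2_ge_0 (sqrt (x + 1) - sqrt x)). nra.
Qed.

(** Up to the factor [k ^ 2], this bounds the sum of the squared radii of the later disks. The
    expanded square is [1/(i+1) - 1/(sqrt m * sqrt (i+1)) + 1/(4m)], and telescoping differences of
    [ln] and [sqrt] bound its first two terms. *)
Lemma sum_inv_sqrt_sub_sq (m p : nat) :
  (0 < m)%nat ->
  ln (INR (m + p) + 1) - ln (INR m + 1)
    - 2 / sqrt (INR m) * (sqrt (INR (m + p)) - sqrt (INR m)) + INR p / (4 * INR m)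
  <= lsum (fun i => (/ sqrt (INR (S i)) - / (2 * sqrt (INR m))) ^ 2) (List.seq m p).
Proof.
  intros Hm. assert (Hm' : 0 < INR m) by now apply lt_0_INR.
  assert (Hs : 0 < sqrt (INR m)) by now apply sqrt_lt_R0.
  assert (Hss := pow2_sqrt (INR m) ltac:(lra)).
  induction p as [|p IH].
  - rewrite Nat.add_0_r. simpl. unfold Rdiv. lra.
  - rewrite seq_S, lsum_app. unfold lsum at 2. cbn [fold_right]. rewrite Rplus_0_r.
    rewrite Nat.add_succ_r, !(S_INR (m + p)), (S_INR p).
    set (x := INR (m + p)) in *.
    assert (Hx : 0 <= x) by apply pos_INR.
    assert (H1 : 0 < sqrt (x + 1)) by (apply sqrt_lt_R0; lra).
    pose proof (ln_succ_sub_le (x + 1) ltac:(lra)) as L1.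
    pose proof (inv_sqrt_succ_le x Hx) as L2.
    assert (E : (/ sqrt (x + 1) - / (2 * sqrt (INR m))) ^ 2
      = / (x + 1) - / sqrt (INR m) * / sqrt (x + 1) + 1 / (4 * INR m)).
    { pose proof (pow2_sqrt (x + 1) ltac:(lra)) as Hu.
      set (u := sqrt (x + 1)) in *. set (s := sqrt (INR m)) in *.
      rewrite <- Hu, <- Hss. field. lra. }
    rewrite E.
    assert (L3 : / sqrt (INR m) * / sqrt (x + 1)
      <= / sqrt (INR m) * (2 * (sqrt (x + 1) - sqrt x))).
    { apply Rmult_le_compat_l; [|easy]. left. now apply Rinv_0_lt_compat. }
    unfold Rdiv in *. lra.
Qed.

(** [ln 2] is [ln ((1 + x) / (1 - x))] at [x = 1/3]. The remainder [f] of its truncated series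
    vanishes at 0 and has derivative [2 * x^8 / (1 - x^2) >= 0]. *)
Lemma ln_2_gt : 0.69313 < ln 2.
Proof.
  set (f := fun x => ln (1 + x) - ln (1 - x) - 2 * (x + x ^ 3 / 3 + x ^ 5 / 5 + x ^ 7 / 7)).
  set (df := fun x => / (1 + x) + / (1 - x) - 2 * (1 + x ^ 2 + x ^ 4 + x ^ 6)).
  assert (Hd : forall x, Rmin 0 (1/3) <= x <= Rmax 0 (1/3) -> is_derive f x (df x)).
  { intros x. rewrite Rmin_left, Rmax_right by lra. intros Hx.
    unfold f, df. auto_derive; [repeat split; lra|]. field. lra. }
  destruct (MVT_gen f 0 (1/3) df) as (c & Hc & E).
  - intros x Hx. apply Hd. lra.
  - intros x Hx. apply derivable_continuous_pt.
    exists (df x). now apply is_derive_Reals, Hd.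
  - rewrite Rmin_left, Rmax_right in Hc by lra.
    assert (0 <= df c).
    { unfold df.
      replace (/ (1 + c) + / (1 - c) - 2 * (1 + c ^ 2 + c ^ 4 + c ^ 6))
        with (2 * (c ^ 4) ^ 2 / ((1 + c) * (1 - c))) by (field; lra).
      apply Rmult_le_pos; [pose proof (pow2_ge_0 (c ^ 4)); lra|].
      left. apply Rinv_0_lt_compat. nra. }
    assert (Hf0 : f 0 = 0) by (unfold f; rewrite Rplus_0_r, Rminus_0_r, ln_1; field).
    assert (Hf : f (1 / 3) = ln 2 - 2 * (1/3 + (1/3)^3 / 3 + (1/3)^5 / 5 + (1/3)^7 / 7)).
    { unfold f. rewrite <- ln_div by lra. do 2 f_equal. field. }
    assert (0 <= f (1 / 3)) by nra. lra.
Qed.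

(** A partial sum of the alternating series for [PI / 4 = 2 * atan (1/3) + atan (1/7)]. *)
Lemma PI_gt : 3.141 < PI.
Proof.
  destruct (PI_2_3_7_ineq 1) as [H _]. simpl in H.
  unfold tg_alt, PI_2_3_7_tg, Ratan_seq in H. simpl in H. lra.
Qed.

Lemma density_constant (m : nat) :
  10 ^ 8 <= INR m ->
  1.183 ^ 2 <= PI * 1.154 * (ln (INR (4 * m) + 1) - ln (INR m + 1) - 1).
Proof.
  intros Hm. pose proof ln_2_gt. pose proof PI_gt.
  rewrite mult_INR. replace (INR 4) with 4 by (simpl; lra).
  set (x := INR m) in *.
  (* The difference of logarithms falls short of [2 * ln 2] by the logarithm of
     [1 + 3 / (4 * x + 1)], which is at most [3 / 10^8]. *)
  assert (1.3862 <= ln (4 * x + 1) - ln (x + 1)).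
  { assert (Hy : 4 * (x + 1) / (4 * x + 1) = 1 + 3 / (4 * x + 1)) by (field; lra).
    assert (0 < 3 / (4 * x + 1)) by (apply Rdiv_lt_0_compat; lra).
    assert (3 / (4 * x + 1) <= 3 / 10 ^ 8).
    { apply Rmult_le_compat_l; [lra|]. apply Rinv_le_contravar; lra. }
    pose proof (ln_le_minus_1 (4 * (x + 1) / (4 * x + 1)) ltac:(lra)) as L.
    rewrite Hy in L at 2. rewrite ln_div, ln_mult in L by lra.
    replace (ln 4) with (ln 2 + ln 2) in L by (rewrite <- ln_mult by lra; f_equal; lra).
    lra. }
  nra.
Qed.

(** * Distance to the boundary of the square *)

Lemma pt_dist_sym (X Z : pt) : Defs.dist X Z = Defs.dist Z X.
Proof. unfold Defs.dist. f_equal. ring. Qed.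

Lemma le_dist_bd (v : R) (X : pt) :
  v <= fst X <= 1 - v -> v <= snd X <= 1 - v -> Rbar_le v (dist_bd X).
Proof.
  intros H1 H2. apply Glb_Rbar_correct. intros z (Z & [_ HZ] & ->). simpl.
  destruct (Rle_lt_dec v 0) as [Hv|Hv].
  { apply Rle_trans with (1 := Hv), sqrt_pos. }
  unfold Defs.dist. rewrite <- (sqrt_pow2 v) by lra. apply sqrt_le_1_alt.
  pose proof (pow2_ge_0 (fst X - fst Z)). pose proof (pow2_ge_0 (snd X - snd Z)).
  destruct HZ as [E|[E|[E|E]]]; rewrite E in *; nra.
Qed.

(** The orthogonal projections of [X] onto the four sides serve as test points. *)
Lemma le_dist_bd_inv (v : R) (X : pt) :
  inP X -> Rbar_le v (dist_bd X) -> v <= fst X <= 1 - v /\ v <= snd X <= 1 - v.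
Proof.
  intros [H1 H2] Hv.
  assert (H : forall Z, onBoundary Z -> v <= Defs.dist X Z).
  { intros Z HZ. apply (Rbar_le_trans v _ (Defs.dist X Z) Hv).
    apply Glb_Rbar_correct. eauto. }
  assert (Hx : forall z, z = 0 \/ z = 1 -> v <= Rabs (fst X - z)).
  { intros z Hz. specialize (H (z, snd X)). unfold Defs.dist in H. simpl fst in H.
    simpl snd in H. rewrite Rminus_diag, pow_i, Rplus_0_r in H by lia.
    rewrite <- Rsqr_pow2, sqrt_Rsqr_abs in H. apply H.
    split; [split; simpl; lra|simpl; tauto]. }
  assert (Hy : forall z, z = 0 \/ z = 1 -> v <= Rabs (snd X - z)).
  { intros z Hz. specialize (H (fst X, z)). unfold Defs.dist in H. simpl fst in H.
    simpl snd in H. rewrite Rminus_diag, pow_i, Rplus_0_l in H by lia.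
    rewrite <- Rsqr_pow2, sqrt_Rsqr_abs in H. apply H.
    split; [split; simpl; lra|simpl; tauto]. }
  pose proof (Hx 0 (or_introl eq_refl)) as Hx0. pose proof (Hx 1 (or_intror eq_refl)) as Hx1.
  pose proof (Hy 0 (or_introl eq_refl)) as Hy0. pose proof (Hy 1 (or_intror eq_refl)) as Hy1.
  rewrite Rabs_right in Hx0, Hy0 by lra. rewrite Rabs_left1 in Hx1, Hy1 by lra.
  lra.
Qed.

(** * Instances whose points are all present together *)

(** Everything arrives at time 0 and leaves at time 1. No departure precedes an arrival, so the view
    of a point does not reveal [n]. *)
Definition static (n : nat) : instance := repeat (0, 1) n.

Lemma static_length (n : nat) : length (static n) = n.
Proof. apply repeat_length. Qed.

Lemma static_s (n i : nat) : s_ (static n) i = 0.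
Proof.
  unfold s_, static. destruct (Nat.lt_ge_cases i n).
  - now rewrite nth_repeat_lt.
  - rewrite nth_overflow; [easy|]. now rewrite repeat_length.
Qed.

Lemma static_d (n i : nat) : (i < n)%nat -> d_ (static n) i = 1.
Proof. intros. unfold d_, static. now rewrite nth_repeat_lt. Qed.

Lemma static_valid (n : nat) : (0 < n)%nat -> valid_instance (static n).
Proof.
  intros Hn. split; [|split; [apply static_s|split]].
  - destruct n; [lia|discriminate].
  - intros i. rewrite static_length. intros Hi. rewrite static_s, static_d by easy. lra.
  - intros. rewrite !static_s. lra.
Qed.

Lemma static_Tmax (n : nat) : (0 < n)%nat -> Tmax (static n) = 1.
Proof.
  intros Hn. unfold Tmax, static. rewrite map_repeat. simpl.
  assert (H : forall k, 0 <= fold_right Rmax 0 (repeat 1 k) <= 1).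
  { intros k. induction k; simpl; [lra|].
    split; [eapply Rle_trans; [|apply Rmax_l]|apply Rmax_lub]; lra. }
  destruct n as [|n]; [lia|]. simpl. apply Rmax_left, H.
Qed.

Lemma static_view (n m i : nat) :
  (i < n)%nat -> (i < m)%nat -> view (static n) i = view (static m) i.
Proof.
  intros Hn Hm. unfold view. apply map_ext_in. intros j Hj. apply in_seq in Hj.
  rewrite !static_s, !static_d by lia. reflexivity.
Qed.

Definition dispersed (n : nat) (X : nat -> pt) (v : R) : Prop :=
  forall i, (i < n)%nat ->
    Rbar_le v (dist_bd (X i)) /\
    forall j, (j < n)%nat -> i <> j -> v <= Defs.dist (X i) (X j).

Lemma le_fold_Rbar_min (v : Rbar) (l : list Rbar) :
  Rbar_le v (fold_right Rbar_min p_infty l) <-> forall x, In x l -> Rbar_le v x.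
Proof.
  induction l as [|y l IH]; simpl.
  - split; [easy|]. now destruct v.
  - split.
    + intros H x [->|Hx].
      * eapply Rbar_le_trans; [exact H|apply Rbar_min_l].
      * apply IH; [|easy]. eapply Rbar_le_trans; [exact H|apply Rbar_min_r].
    + intros H. apply Rbar_min_case; [|apply IH]; auto.
Qed.

Lemma le_dmin_static (n : nat) (X : nat -> pt) (t v : R) :
  0 <= t <= 1 -> Rbar_le v (dmin (static n) X t) <-> dispersed n X v.
Proof.
  intros Ht.
  assert (Hp : forall i, (i < n)%nat -> presentb (static n) t i = true).
  { intros i Hi. unfold presentb. rewrite static_s, static_d by easy.
    destruct (Rle_dec 0 t); [|lra]. destruct (Rle_dec t 1); [easy|lra]. }
  unfold dmin. rewrite static_length, le_fold_Rbar_min. split.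
  - intros H i Hi.
    assert (Hs : In i (List.seq 0 n)) by (apply in_seq; lia).
    specialize (H _ (in_map _ _ _ Hs)). cbv beta in H. rewrite Hp in H by easy.
    split.
    + eapply Rbar_le_trans; [exact H|apply Rbar_min_l].
    + intros j Hj Hij.
      assert (H' := Rbar_le_trans _ _ _ H (Rbar_min_r _ _)).
      rewrite le_fold_Rbar_min in H'.
      assert (Hsj : In j (List.seq 0 n)) by (apply in_seq; lia).
      specialize (H' _ (in_map _ _ _ Hsj)). cbv beta in H'. rewrite Hp in H' by easy.
      apply Nat.eqb_neq in Hij. now rewrite Hij in H'.
  - intros H x Hx. apply in_map_iff in Hx. destruct Hx as (i & <- & Hi).
    apply in_seq in Hi. rewrite Hp by lia. destruct (H i ltac:(lia)) as [Hb Hd].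
    apply Rbar_min_case; [easy|]. apply le_fold_Rbar_min.
    intros x Hx. apply in_map_iff in Hx. destruct Hx as (j & <- & Hj).
    apply in_seq in Hj. rewrite Hp by lia.
    destruct (Nat.eqb i j) eqn:E; [easy|]. apply Nat.eqb_neq in E.
    apply Hd; lia || easy.
Qed.

(** On [[0, 1]] the value [dmin] does not depend on time, so the infimum is its value at time 0; it
    remains to exclude infinite values. *)
Lemma static_minval (n : nat) (X : nat -> pt) :
  (0 < n)%nat -> (forall i, (i < n)%nat -> inP (X i)) ->
  exists v, minval (static n) X = Finite v /\ forall w, w <= v <-> dispersed n X w.
Proof.
  intros Hn HX.
  assert (D0 : dispersed n X 0).
  { intros i Hi. destruct (HX i Hi). split; [apply le_dist_bd; lra|].
    intros; apply sqrt_pos. }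
  destruct (dmin (static n) X 0) as [v| |] eqn:Ev.
  - exists v.
    assert (Hv : forall w, w <= v <-> dispersed n X w).
    { intros w. rewrite <- (le_dmin_static n X 0) by lra. now rewrite Ev. }
    split; [|easy].
    apply is_glb_Rbar_unique. split.
    + intros z (t & Ht & Hz). rewrite static_Tmax in Ht by easy. simpl.
      enough (H : Rbar_le v (dmin (static n) X t)) by now rewrite Hz in H.
      apply le_dmin_static; [easy|]. apply Hv. lra.
    + intros b Hb. apply Hb. exists 0. rewrite static_Tmax by easy. split; [lra|easy].
  (* The value [p_infty] would keep point 0 at distance at least 2 from the boundary. *)
  - assert (H : dispersed n X 2) by (apply (le_dmin_static n X 0); [lra|now rewrite Ev]).
    destruct (H 0%nat Hn) as [H0 _].
    pose proof (le_dist_bd_inv _ _ (HX 0%nat Hn) H0). lra.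
  - apply (le_dmin_static n X 0) in D0; [|lra]. now rewrite Ev in D0.
Qed.

Lemma le_OPT_static (n : nat) (X : nat -> pt) (v : R) :
  (0 < n)%nat -> (forall i, (i < n)%nat -> inP (X i)) -> dispersed n X v ->
  Rbar_le v (OPT_A (static n)).
Proof.
  intros Hn HX HD. destruct (static_minval n X Hn HX) as (w & Ew & Hw).
  apply Rbar_le_trans with (Finite w); [now apply Hw|].
  apply Lub_Rbar_correct. exists X. now rewrite static_length.
Qed.

(** By causality point [i] is placed in [static n] as in [static (S i)], where it is the last one;
    so a single sequence of locations serves all [n]. *)
Lemma competitive_dispersed (A : algorithm) (sigma g : R) (n : nat) :
  online A -> competitive A sigma -> (0 < n)%nat ->
  0 < g -> Rbar_le g (OPT_A (static n)) ->
  0 < sigma /\ dispersed n (fun i => A (static (S i)) i) (g / sigma).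
Proof.
  intros [HP HV] HC Hn Hg HO.
  assert (HA : forall i, (i < n)%nat -> A (static n) i = A (static (S i)) i).
  { intros i Hi. apply HV; rewrite ?static_length; try lia;
      [apply static_valid; lia|apply static_valid; lia|apply static_view; lia]. }
  destruct (static_minval n (A (static n)) Hn) as (v & Ev & Hv).
  { intros i Hi. apply HP; [now apply static_valid|now rewrite static_length]. }
  specialize (HC _ (static_valid n Hn)). rewrite Ev in HC.
  assert (Hle := Rbar_le_trans _ _ _ HO HC). simpl in Hle.
  assert (0 <= v).
  { apply Hv. intros i Hi.
    destruct (HP (static n) i (static_valid n Hn)); [now rewrite static_length|].
    split; [apply le_dist_bd; lra|intros; apply sqrt_pos]. }
  (* Positivity of [sigma] follows from [0 < g <= sigma * v] with [0 <= v]. *)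
  assert (Hs : 0 < sigma) by nra. split; [easy|].
  assert (D : dispersed n (A (static n)) (g / sigma)).
  { apply Hv. apply Rmult_le_reg_l with sigma; [easy|].
    replace (sigma * (g / sigma)) with g by (field; lra). easy. }
  intros i Hi. destruct (D i Hi) as [D1 D2]. rewrite <- HA by easy. split; [easy|].
  intros j Hj. rewrite <- HA by easy. now apply D2.
Qed.

(** * Offline solutions from the triangular lattice *)

(* Row spacing [0.8661 d] instead of [sqrt 3 / 2 * d] keeps the numerics rational. *)
Definition lattice (d : R) (q c : nat) : pt :=
  (d + INR c * d + (if Nat.even q then 0 else d / 2), d + INR q * (0.8661 * d)).

(** In one row, offsets are nonzero multiples of [d]. Adjacent rows are shifted by at least [d / 2],
    and [1/4 + 0.8661^2 >= 1]. Rows further apart differ in height by at least [2 * 0.8661 * d]. *)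
Lemma lattice_dist (d : R) (q c q' c' : nat) :
  0 <= d -> q <> q' \/ c <> c' -> d <= Defs.dist (lattice d q c) (lattice d q' c').
Proof.
  revert q c q' c'.
  enough (W : forall q c q' c', 0 <= d -> (q <= q')%nat -> q <> q' \/ c <> c' ->
    d <= Defs.dist (lattice d q c) (lattice d q' c')).
  { intros q c q' c' Hd H. destruct (Nat.le_ge_cases q q').
    - now apply W.
    - rewrite pt_dist_sym. apply W; lia || easy. }
  intros q c q' c' Hd Hq H. unfold Defs.dist, lattice. simpl fst; simpl snd.
  rewrite <- (sqrt_pow2 d) at 1 by easy. apply sqrt_le_1_alt.
  rewrite !INR_IZR_INZ.
  set (a := (Z.of_nat c - Z.of_nat c')%Z).
  replace (IZR (Z.of_nat c)) with (IZR (Z.of_nat c') + IZR a)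
    by (rewrite <- plus_IZR; f_equal; lia).
  set (x := IZR (Z.of_nat c')). clearbody x.
  destruct (Nat.eq_dec q q') as [<-|Hne].
  - assert (Ha : (a <= -1 \/ 1 <= a)%Z) by lia.
    assert (1 <= IZR a ^ 2) by (destruct Ha as [Ha|Ha]; apply IZR_le in Ha; nra).
    match goal with |- _ <= ?e => replace e with (IZR a ^ 2 * d ^ 2) by ring end.
    pose proof (pow2_ge_0 d). nra.
  - set (b := (Z.of_nat q' - Z.of_nat q)%Z).
    replace (IZR (Z.of_nat q')) with (IZR (Z.of_nat q) + IZR b)
      by (rewrite <- plus_IZR; f_equal; lia).
    destruct (Nat.eq_dec q' (S q)) as [->|Hne2].
    + replace b with 1%Z by lia.
      rewrite Nat.even_succ, <- Nat.negb_even.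
      assert (Ha : (a <= -1 \/ a = 0 \/ 1 <= a)%Z) by lia.
      (* For an integer [a] this says that [(a - 1/2)^2] and [(a + 1/2)^2] are at least 1/4. *)
      assert (0 <= IZR a ^ 2 - IZR a /\ 0 <= IZR a ^ 2 + IZR a) as [H1 H2].
      { destruct Ha as [Ha|[->|Ha]]; [|lra|]; apply IZR_le in Ha; split; nra. }
      pose proof (pow2_ge_0 d).
      destruct (Nat.even q); simpl negb; cbv iota;
      match goal with |- _ <= ?e => ring_simplify e end; nra.
    + assert (Hb : (2 <= b)%Z) by lia. apply IZR_le in Hb.
      match goal with |- _ <= ?u ^ 2 + ?e => pose proof (pow2_ge_0 u);
        replace e with (0.8661 ^ 2 * IZR b ^ 2 * d ^ 2) by ring end.
      assert (4 <= IZR b ^ 2) by nra. pose proof (pow2_ge_0 d). nra.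
Qed.

Lemma lattice_OPT (n : nat) :
  10 ^ 8 <= INR n -> Rbar_le (sqrt 1.154 / sqrt (INR n)) (OPT_A (static n)).
Proof.
  intros Hn. set (d := sqrt 1.154 / sqrt (INR n)).
  assert (Hsn : 10 ^ 4 <= sqrt (INR n)).
  { rewrite <- (sqrt_pow2 (10 ^ 4)) by lra. apply sqrt_le_1_alt. lra. }
  assert (Hk : 0 < sqrt 1.154 < 1.08).
  { split; [apply sqrt_lt_R0; lra|].
    rewrite <- (sqrt_pow2 1.08) by lra. apply sqrt_lt_1_alt. lra. }
  assert (Hd : 0 < d) by (apply Rdiv_lt_0_compat; lra).
  assert (Hdn : INR n * d ^ 2 = 1.154).
  { unfold d, Rdiv. rewrite Rpow_mult_distr, pow_inv, !pow2_sqrt by lra. field. lra. }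
  assert (Hdu : d <= 1.08 / 10 ^ 4).
  { unfold d. apply Rmult_le_compat; try lra.
    - left. apply Rinv_0_lt_compat. lra.
    - apply Rinv_le_contravar; lra. }
  assert (Hid : 9000 <= / d).
  { rewrite <- (Rinv_inv 9000). apply Rinv_le_contravar; lra. }
  assert (Hdi : / d * d = 1) by (field; lra).
  (* [C] is the number of points per row: margins [d] on both sides and the shift [d / 2] require
     [C * d <= 1 - 1.5 * d]. [Q] is the index of the last row. *)
  destruct (nfloor_ex (/ d - 1.5) ltac:(lra)) as [C HC].
  destruct (nfloor_ex ((1 - 2 * d) / (0.8661 * d))) as [Q HQ].
  { apply Rmult_le_pos; [lra|]. left. apply Rinv_0_lt_compat. lra. }
  assert (HQd : (1 - 2 * d) / (0.8661 * d) * (0.8661 * d) = 1 - 2 * d) by (field; lra).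
  set (w := (1 - 2 * d) / (0.8661 * d)) in *.
  assert (HC1 : INR C * d <= 1 - 1.5 * d) by nra.
  assert (HC2 : 1 - 2.5 * d <= INR C * d) by nra.
  assert (HQ1 : INR Q * (0.8661 * d) <= 1 - 2 * d) by nra.
  assert (HQ2 : 1 - 2 * d <= (INR Q + 1) * (0.8661 * d)) by nra.
  (* The grid has room for [n] points: [n * 0.8661 * d^2 = 0.8661 * 1.154 < 0.9995], while
     [(1 - 2.5 * d) * (1 - 2 * d)] stays above 0.9995 for [d <= 1.08 / 10^4]. *)
  assert (HnCQ : (n <= C * S Q)%nat).
  { apply INR_le. rewrite mult_INR, S_INR.
    apply Rmult_le_reg_r with (0.8661 * d ^ 2); [nra|].
    assert ((1 - 2.5 * d) * (1 - 2 * d) <= INR C * d * ((INR Q + 1) * (0.8661 * d)))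
      by (apply Rmult_le_compat; lra).
    nra. }
  assert (H0n : (0 < n)%nat) by (apply INR_lt; simpl; lra).
  assert (HC0 : (C <> 0)%nat) by lia.
  set (X := fun k => lattice d (k / C) (k mod C)).
  assert (HX : forall i, (i < n)%nat ->
    d <= fst (X i) <= 1 - d /\ d <= snd (X i) <= 1 - d).
  { intros i Hi. unfold X, lattice. simpl fst; simpl snd.
    assert (Hm : (S (i mod C) <= C)%nat) by (apply Nat.mod_upper_bound; lia).
    assert (Hq : (i / C <= Q)%nat).
    { apply Nat.lt_succ_r, Nat.Div0.div_lt_upper_bound. lia. }
    apply le_INR in Hm, Hq. rewrite S_INR in Hm.
    pose proof (pos_INR (i mod C)). pose proof (pos_INR (i / C)).
    destruct (Nat.even (i / C)); split; split; nra. }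
  apply le_OPT_static with X; [easy|..].
  - intros i Hi. destruct (HX i Hi). split; lra.
  - intros i Hi. destruct (HX i Hi). split; [now apply le_dist_bd|].
    intros j Hj Hij. apply lattice_dist; [lra|].
    destruct (Nat.eq_dec (i / C) (j / C)) as [E|]; [right|now left].
    intros E'. apply Hij.
    rewrite (Nat.div_mod_eq i C), (Nat.div_mod_eq j C). now rewrite E, E'.
Qed.

(** * Area count against the online algorithm *)

Theorem theorem4 :
  forall (A : algorithm), online A ->
  forall sigma : R, sigma < 1.183 -> ~ competitive A sigma.
Proof.
  intros A HA sigma Hsig HC.
  (* Beyond this size both the lattice bound and [density_constant] apply. *)
  destruct (INR_unbounded (10 ^ 8)) as [m Hm].
  assert (Hm0 : (0 < m)%nat) by (apply INR_lt; simpl; lra).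
  set (X := fun i => A (static (S i)) i).
  set (k := sqrt 1.154 / sigma).
  assert (HD : forall n, (m <= n)%nat ->
    0 < sigma /\ dispersed n X (k / sqrt (INR n))).
  { intros n Hn. apply le_INR in Hn.
    assert (0 < sqrt (INR n)) by (apply sqrt_lt_R0; lra).
    destruct (competitive_dispersed A sigma (sqrt 1.154 / sqrt (INR n)) n) as [Hs D]; auto.
    - apply INR_lt; simpl; lra.
    - apply Rdiv_lt_0_compat; [apply sqrt_lt_R0|]; lra.
    - apply lattice_OPT; lra.
    - split; [easy|].
      replace (k / sqrt (INR n)) with (sqrt 1.154 / sqrt (INR n) / sigma); [easy|].
      unfold k. field. lra. }
  destruct (HD m (le_n m)) as [Hs Dm].
  assert (Hk : 0 < k) by (apply Rdiv_lt_0_compat; [apply sqrt_lt_R0|]; lra).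
  set (M := (4 * m)%nat).
  assert (HM : sqrt (INR M) = 2 * sqrt (INR m)).
  { unfold M. rewrite mult_INR, sqrt_mult by (apply pos_INR || lra).
    replace (INR 4) with (2 ^ 2) by (simpl; ring). rewrite sqrt_pow2; lra. }
  assert (Hsm : 0 < sqrt (INR m)) by (apply sqrt_lt_R0; lra).
  set (r := fun i => if Nat.ltb i m then k / (2 * sqrt (INR m))
                     else k * (/ sqrt (INR (S i)) - / (2 * sqrt (INR m)))).
  assert (Hr : forall i, (i < M)%nat -> 0 <= r i <= k / (2 * sqrt (INR m))
    /\ ((m <= i)%nat -> r i = k / sqrt (INR (S i)) - k / (2 * sqrt (INR m)))).
  { intros i Hi. unfold r. destruct (Nat.ltb i m) eqn:E.
    - apply Nat.ltb_lt in E. split; [|lia]. split; [|lra].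
      apply Rmult_le_pos; [lra|]. left. apply Rinv_0_lt_compat. lra.
    - apply Nat.ltb_ge in E. split; [|intros; unfold Rdiv; ring].
      (* Here [m < i + 1 <= 4 * m], so [sqrt (i + 1)] lies between [sqrt m] and [2 * sqrt m]. *)
      assert (/ (2 * sqrt (INR m)) <= / sqrt (INR (S i)) <= / sqrt (INR m)).
      { split; apply Rinv_le_contravar; try lra.
        - apply sqrt_lt_R0, lt_0_INR. lia.
        - rewrite <- HM. apply sqrt_le_1_alt, le_INR. lia.
        - apply sqrt_le_1_alt, le_INR. lia. }
      assert (/ (2 * sqrt (INR m)) = / sqrt (INR m) / 2) by (field; lra).
      unfold Rdiv in *. split; nra. }
  assert (Harea : PI * lsum (fun i => r i ^ 2) (List.seq 0 M) <= 1).
  { apply disjoint_disks_area with X.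
    - apply seq_NoDup.
    - intros i Hi. apply in_seq in Hi. destruct (Hr i) as [Hri _]; [lia|].
      (* The prefix of length [M] keeps each point [k / (2 * sqrt m)] away from the boundary, which
         is at least [r i]. *)
      destruct (HD M ltac:(lia)) as [_ DM]. destruct (DM i ltac:(lia)) as [Hb _].
      rewrite HM in Hb.
      assert (Hin : inP (X i)).
      { apply HA; [apply static_valid|rewrite static_length]; lia. }
      destruct (le_dist_bd_inv _ _ Hin Hb). lra.
    (* For [i < m] the two radii add up to [k / sqrt m], the scale of the prefix of length [m].
       Otherwise [r j <= k / (2 * sqrt m)] cancels the subtracted term of [r i], leaving
       [k / sqrt (i + 1)], the scale of the prefix ending at [i]. *)
    - assert (W : forall i j, (j < i)%nat -> (i < M)%nat ->
        r i + r j <= Defs.dist (X i) (X j)).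
      { intros i j Hij Hi.
        destruct (Hr i) as [Hri Hri']; [lia|]. destruct (Hr j) as [Hrj _]; [lia|].
        destruct (Nat.lt_ge_cases i m) as [Him|Him].
        - destruct (Dm i Him) as [_ D]. specialize (D j ltac:(lia) ltac:(lia)).
          assert (k / sqrt (INR m) = k / (2 * sqrt (INR m)) + k / (2 * sqrt (INR m)))
            by (field; lra).
          lra.
        - destruct (HD (S i) ltac:(lia)) as [_ DS].
          destruct (DS i ltac:(lia)) as [_ D]. specialize (D j ltac:(lia) ltac:(lia)).
          specialize (Hri' Him). lra. }
      intros i j Hi Hj Hne. apply in_seq in Hi, Hj.
      destruct (Nat.lt_ge_cases j i); [apply W; lia|].
      rewrite pt_dist_sym, Rplus_comm. apply W; lia. }
  replace M with (m + 3 * m)%nat in Harea by (unfold M; lia).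
  rewrite seq_app, lsum_app in Harea. rewrite Nat.add_0_l in Harea.
  assert (Hsm2 := pow2_sqrt (INR m) ltac:(lra)).
  assert (E1 : lsum (fun i => r i ^ 2) (List.seq 0 m) = k ^ 2 / 4).
  { transitivity (lsum (fun _ => (k / (2 * sqrt (INR m))) ^ 2) (List.seq 0 m)).
    - apply Rle_antisym; apply lsum_le; intros i Hi; apply in_seq in Hi; unfold r;
        destruct (Nat.ltb_spec i m); lra || lia.
    - assert (Hc : forall c l, lsum (fun _ => c) l = INR (length l) * c).
      { intros c l. induction l as [|i l IH]; [simpl; ring|].
        cbn [length]. rewrite S_INR. simpl. rewrite IH. ring. }
      rewrite Hc, length_seq. rewrite <- Hsm2 at 1. field. lra. }
  assert (E2 : lsum (fun i => r i ^ 2) (List.seq m (3 * m)) =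
    k ^ 2 * lsum (fun i => (/ sqrt (INR (S i)) - / (2 * sqrt (INR m))) ^ 2)
              (List.seq m (3 * m))).
  { rewrite <- lsum_scal. apply Rle_antisym; apply lsum_le; intros i Hi;
      apply in_seq in Hi; unfold r; destruct (Nat.ltb_spec i m); try lia; nra. }
  (* With [3 * m] terms the bound is [L - 2 + 3/4]; the first [m] disks add the 1/4 of [E1], which
     gives [L - 1]. *)
  pose proof (sum_inv_sqrt_sub_sq m (3 * m) Hm0) as Hsum.
  replace (m + 3 * m)%nat with M in Hsum by (unfold M; lia).
  rewrite HM in Hsum.
  replace (2 / sqrt (INR m) * (2 * sqrt (INR m) - sqrt (INR m))) with 2 in Hsum
    by (field; lra).
  replace (INR (3 * m) / (4 * INR m)) with (3 / 4) in Hsum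
    by (rewrite mult_INR; simpl (INR 3); field; lra).
  pose proof (density_constant m ltac:(lra)) as Hnum. fold M in Hnum.
  rewrite E1, E2 in Harea.
  set (L := ln (INR M + 1) - ln (INR m + 1)) in *.
  set (Q := lsum _ _) in Harea, Hsum.
  assert (Hk2 : k ^ 2 * sigma ^ 2 = 1.154).
  { unfold k, Rdiv. rewrite Rpow_mult_distr, pow_inv, pow2_sqrt by lra. field. lra. }
  assert (Hs2 : 0 < sigma ^ 2 < 1.183 ^ 2) by (split; nra).
  pose proof PI_RGT_0 as HPI.
  assert (PI * (k ^ 2 * (L - 1)) <= 1).
  { apply Rle_trans with (2 := Harea). apply Rmult_le_compat_l; [lra|].
    pose proof (pow2_ge_0 k). nra. }
  assert (PI * 1.154 * (L - 1) <= sigma ^ 2).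
  { rewrite <- Hk2.
    replace (PI * (k ^ 2 * sigma ^ 2) * (L - 1)) with (sigma ^ 2 * (PI * (k ^ 2 * (L - 1))))
      by ring.
    nra. }
  lra.
Qed.
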